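(* Let $T=(V,E)$ be a tree rooted at $v_1$, with leaf set $Y=\{t_0,t_1,\dots,t_{r-1}\}$ and a designated leaf $t_0$. For each leaf $t_i$ let $P_i$ be the set of edges of the unique path from $v_1$ to $t_i$. Let $l,w,u:E\to\mathbb{R}$ satisfy $l(e)\le w(e)\le u(e)$ for all $e\in E$, let $c:E\to\mathbb{R}_{>0}$, and let $D\in\mathbb{R}$. Let $C_1<C_2<\dots<C_{n^*}$ be the distinct values of $\{c(e):e\in E\}$, and for $k\in\{1,\dots,n^*\}$ let $E_k=\{e\in E: c(e)\le C_k\}$. Then the problem (RIOVSPT$_{BH}$) has a feasible solution $\tilde w$ with objective value $C(\tilde w)\le C_k$ if and only if both of the following hold: 1. $l(P_0\cap E_k)+w(P_0\setminus E_k)\le D\le u(P_i\cap E_k)+w(P_i\setminus E_k)$ for all $t_i\in Y$; and 2. $l(P_0\cap E_k)+w(P_0\setminus E_k)\le l(P_i\cap P_0\cap E_k)+u((P_i\setminus P_0)\cap E_k)+w(P_i\setminus E_k)$ for all $t_i\in Y$.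
   Context: For $f:E\to\mathbb{R}$ and $S\subseteq E$, $f(S):=\sum_{e\in S}f(e)$. The Hamming distance is $H(a,b)=1$ if $a\ne b$ and $H(a,b)=0$ if $a=b$. The problem (RIOVSPT$_{BH}$) is: minimize $C(\tilde w):=\max_{e\in E}c(e)H(\tilde w(e),w(e))$ over $\tilde w:E\to\mathbb{R}$ subject to $\tilde w(P_k)\ge D$ for all leaves $t_k\in Y$, $\tilde w(P_0)=D$, and $l(e)\le\tilde w(e)\le u(e)$ for all $e\in E$. A feasible solution is any $\tilde w$ satisfying these constraints. *)

(* Defs.v *)
From HB Require Import structures.
From mathcomp Require Import all_boot all_order all_algebra.
From mathcomp Require Import reals.

Set Implicit Arguments.
Unset Strict Implicit.
Unset Printing Implicit Defensive.

Import Order.TTheory GRing.Theory Num.Theory.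
Local Open Scope ring_scope.

Section Trees.
Variables (V : finType) (adj : rel V).

(* [ucycle] also accepts the closed walk x, y, x along a single edge, which is
   not a graph cycle; hence the bound 2. *)
Definition acyclic : Prop := forall s : seq V, ucycle adj s -> (size s <= 2)%N.

Definition is_tree : Prop :=
  [/\ symmetric adj, irreflexive adj, (forall x y, connect adj x y) & acyclic].

Definition is_edge (A : {set V}) : bool :=
  [exists x, exists y, adj x y && (A == [set x; y])].

Definition edge : finType := {A : {set V} | is_edge A}.

(* The root is not a leaf, even when it has degree 1. *)
Definition leaves (root : V) : {set V} :=
  [set t | (t != root) && (#|[set x | adj t x]| == 1)%N].

Definition simple_path (x y : V) (p : seq V) : bool :=
  [&& path adj x p, uniq (x :: p) & last x p == y].

(* [pairmap] lists the pairs of consecutive vertices of x :: p. *)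
Definition path_edges (x : V) (p : seq V) : {set edge} :=
  [set e : edge | val e \in pairmap (fun a b => [set a; b]) x p].

Definition is_path_edge_set (x y : V) (S : {set edge}) : Prop :=
  exists2 p : seq V, simple_path x y p & S = path_edges x p.

End Trees.

Section Problem.
Variables (R : realType) (E : finType).

Definition fsum (f : E -> R) (S : {set E}) : R := \sum_(e in S) f e.

Definition hamming (a b : R) : R := (a != b)%:R.

(* The neutral element 0 is harmless: all terms are nonnegative when c > 0. *)
Definition objective (c w wt : E -> R) : R :=
  \big[Num.max/0]_(e : E) (c e * hamming (wt e) (w e)).

Definition feasible (V : finType) (Y : {set V}) (P : V -> {set E}) (t0 : V)
    (l u : E -> R) (D : R) (wt : E -> R) : Prop :=
  [/\ forall t, t \in Y -> D <= fsum wt (P t),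
      fsum wt (P t0) = D
    & forall e, l e <= wt e <= u e].

Definition cost_values (c : E -> R) : seq R :=
  sort <=%R (undup [seq c e | e : E]).

(* Numbered from 1: meaningful for 1 <= k <= size (cost_values c). *)
Definition cost_value (c : E -> R) (k : nat) : R := nth 0 (cost_values c) k.-1.

Definition cheap_edges (c : E -> R) (k : nat) : {set E} :=
  [set e | c e <= cost_value c k].

End Problem.

(* Main.v *)
Require Import Defs.
From HB Require Import structures.
From mathcomp Require Import all_boot all_order all_algebra.
From mathcomp Require Import reals.
From mathcomp Require Import lra.

Set Implicit Arguments.
Unset Strict Implicit.
Unset Printing Implicit Defensive.

Import Order.TTheory GRing.Theory Num.Theory.
Local Open Scope ring_scope.

(* Restricted to the edges that may be modified at cost at most C_k, the
   problem asks for weights between bounds L and U (both equal to w outside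
   E_k).  Off P_0 the best choice is U.  On P_0 the total must be D, and each
   leaf t_i bounds the weight of P_i :&: P_0 from below.  Because the graph is
   a tree, P_i :&: P_0 is an initial segment of P_0, so pushing the weight of
   P_0 greedily towards the root maximizes all these partial sums at once: the
   initial segment I gets min(U(I), D - L(P_0 :\: I)), and conditions 1 and 2
   say that both terms of this minimum are large enough. *)

Definition consecutive_pairs (V : finType) (x : V) (p : seq V) : seq {set V} :=
  pairmap (fun a b => [set a; b]) x p.

Lemma consecutive_pairs_sub (V : finType) (x z : V) p A :
  A \in consecutive_pairs x p -> z \in A -> z \in x :: p.
Proof.
elim: p x => [//|a p IHp] x /=; rewrite in_cons => /orP[/eqP->|Ap zA].
  by rewrite !inE => /orP[/eqP->|/eqP->]; rewrite eqxx ?orbT.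
by rewrite in_cons (IHp a) ?orbT.
Qed.

Lemma consecutive_pairs_neq0 (V : finType) (x : V) p A :
  A \in consecutive_pairs x p -> exists z, z \in A.
Proof.
elim: p x => [//|a p IHp] x /=; rewrite in_cons => /orP[/eqP->|]; last exact: IHp.
by exists x; rewrite !inE eqxx.
Qed.

Lemma consecutive_pairs_notin (V : finType) (x a b : V) p :
  x \notin a :: p -> [set x; b] \notin consecutive_pairs a p.
Proof.
by apply: contra => /consecutive_pairs_sub; apply; rewrite !inE eqxx.
Qed.

Lemma consecutive_pairs_uniq (V : finType) (x : V) p :
  uniq (x :: p) -> uniq (consecutive_pairs x p).
Proof.
elim: p x => [//|a p IHp] x /= /andP[xp up].
by rewrite (consecutive_pairs_notin a xp) IHp.
Qed.

(** If the branches met at [z], following the first from [a] to [z] and the second back to [b] would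
    give a walk avoiding [x]. Made repetition-free and closed through [x], it is a cycle with at
    least three vertices. *)
Lemma acyclic_branches_disjoint (V : finType) (adj : rel V) (x a b z : V) p q :
  symmetric adj -> acyclic adj ->
  path adj x (a :: p) -> path adj x (b :: q) ->
  x \notin a :: p -> x \notin b :: q -> a != b ->
  z \in a :: p -> z \in b :: q -> False.
Proof.
move=> symA acyA /= /andP[xa pp] /andP[xb pq] xp xq neq_ab zp zq.
case/splitPl: zp pp xp => p1 p2 lp1; rewrite cat_path => /andP[pp1 _].
rewrite -cat_cons mem_cat => /norP[xp1 _] {p2}.
case/splitPl: zq pq xq => q1 q2 lq1; rewrite cat_path => /andP[pq1 _].
rewrite -cat_cons mem_cat => /norP[xq1 _] {q2}.
pose r := p1 ++ rev (belast b q1).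
have pr : path adj a r.
  rewrite cat_path pp1 lp1 -lq1 rev_path.
  by rewrite (eq_path (e' := adj)) // => u v; rewrite symA.
have lr : last a r = b.
  rewrite last_cat lp1; case: (q1) lq1 => [<- //|c q'] _ /=.
  by rewrite rev_cons last_rcons.
have xr : x \notin a :: r.
  rewrite -cat_cons mem_cat negb_or xp1 mem_rev.
  by apply: contra xq1; apply: mem_belast.
(* Shortening only discards vertices, so the new walk still avoids [x]. *)
case: (shortenP pr) lr => s ps us ss ls.
have xs : x \notin a :: s.
  apply: contra xr; rewrite !in_cons => /orP[->//|/ss ->]; exact: orbT.
have cyc : ucycle adj (x :: a :: s).
  apply/andP; split; last by rewrite /= in us *; rewrite xs.
  by rewrite /= xa rcons_path ps ls symA.
(* The size bound 2 forces [s] to be empty, so the walk from [a] ends at once and [a = b]. *)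
have := acyA _ cyc; case: s ls {ps us ss xs cyc} => [|//] /= eab.
by rewrite eab eqxx in neq_ab.
Qed.

Lemma pairwise_in (T : eqType) (r : rel T) s :
  {in s &, forall a b, r a b} -> pairwise r s.
Proof.
elim: s => //= a s IHs rs; rewrite IHs => [|b c bs cs]; last first.
  by apply: rs; rewrite in_cons ?bs ?cs orbT.
by rewrite andbT; apply/allP => b bs; apply: rs; rewrite in_cons ?eqxx ?bs ?orbT.
Qed.

(** Two paths from [x] agree up to a branching vertex and share no edge afterwards. The [pairwise]
    form says that the edges of [p] lying on [q] form an initial segment of [p]. *)
Lemma tree_paths_share_prefix (V : finType) (adj : rel V) (x : V) p q :
  symmetric adj -> acyclic adj ->
  path adj x p -> uniq (x :: p) -> path adj x q -> uniq (x :: q) ->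
  pairwise (fun A B => (B \in consecutive_pairs x q)
                       ==> (A \in consecutive_pairs x q))
           (consecutive_pairs x p).
Proof.
move=> symA acyA; elim: p x q => [//|a p IHp] x [|b q] pp up pq uq.
  by apply: pairwise_in.
have xp : x \notin a :: p by case/andP: up.
have xq : x \notin b :: q by case/andP: uq.
rewrite [consecutive_pairs x (a :: p)]/= -/(consecutive_pairs a p) pairwise_cons.
have [eab|neq_ab] := eqVneq a b.
  move: eab pq uq xq => <- pq uq xq.
  apply/andP; split; first by apply/allP => B _; rewrite !inE eqxx /= implybT.
  (* The common first edge does not recur in the tail, so for tail edges lying on [x :: a :: q]
     means lying on [a :: q]. *)
  have neB B : B \in consecutive_pairs a p -> B != [set x; a].
    by apply: contraTneq => ->; apply: consecutive_pairs_notin.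
  apply: (sub_in_pairwise (P := mem (consecutive_pairs a p)))
         (IHp a q _ _ _ _); last 4 first.
  - by case/andP: pp.
  - by case/andP: up.
  - by case/andP: pq.
  - by case/andP: uq.
  - move=> A B Ap Bp /implyP AB; rewrite !in_cons (negPf (neB B Bp)) /=.
    by apply/implyP => /AB ->; rewrite orbT.
  - exact/allP.
(* The paths branch at [x]: a shared edge would provide a common vertex other than [x]. *)
have disj B : B \in consecutive_pairs a p ->
    B \notin consecutive_pairs x (b :: q).
  move=> Bp; apply/negP => Bq; have [z zB] := consecutive_pairs_neq0 Bp.
  have zp := consecutive_pairs_sub Bp zB.
  have := consecutive_pairs_sub Bq zB; rewrite in_cons => /orP[/eqP zx|zq].
    by rewrite -zx zp in xp.
  exact: (acyclic_branches_disjoint symA acyA pp pq xp xq neq_ab zp zq).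
apply/andP; split; first by apply/allP => B /disj /negPf ->.
by apply: pairwise_in => A B _ /disj /negPf ->.
Qed.

(** [path_edges] forgets the order of the edges; the greedy construction needs them listed from the
    root. *)
Lemma path_edge_seq (V : finType) (adj : rel V) (x : V) p :
  path adj x p ->
  exists es : seq (edge adj), map val es = consecutive_pairs x p.
Proof.
elim: p x => [|a p IHp] x /=; first by exists [::].
case/andP=> xa /IHp[es ees].
have exa : is_edge adj [set x; a].
  by apply/existsP; exists x; apply/existsP; exists a; rewrite xa eqxx.
by exists ((Sub _ exa : edge adj) :: es); rewrite /= ees.
Qed.

(** Induction on [es]: the first edge takes all that its upper bound and the lower bounds of the
    later edges allow. Since [x] is chosen before [S], one weighting serves all initial segments,
    hence all leaves. *)
Lemma greedy_weights (R : realFieldType) (E : eqType) (L U : E -> R) es D :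
  uniq es -> (forall e, L e <= U e) ->
  \sum_(e <- es) L e <= D -> D <= \sum_(e <- es) U e ->
  exists x : E -> R,
    [/\ forall e, L e <= x e <= U e,
        forall e, e \notin es -> x e = U e,
        \sum_(e <- es) x e = D
      & forall (S : pred E) m, pairwise (fun a b => S b ==> S a) es ->
          m <= \sum_(e <- es | S e) U e ->
          m <= D - \sum_(e <- es | ~~ S e) L e ->
          m <= \sum_(e <- es | S e) x e].
Proof.
move=> + LU; elim: es D => [|a es IHes] D /=.
  rewrite !big_nil => _ D0 D1; exists U; split => //.
  - by move=> e; rewrite LU lexx.
  - by apply/eqP; rewrite big_nil eq_le D1 D0.
case/andP=> aes ues; rewrite !big_cons => LD DU.
have LUes : \sum_(e <- es) L e <= \sum_(e <- es) U e by apply: ler_sum => e _.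
set xa := Num.min (U a) (D - \sum_(e <- es) L e).
have La := LU a.
have [xa1 xa2] : xa <= U a /\ xa <= D - \sum_(e <- es) L e.
  by rewrite /xa; split; rewrite ge_min lexx ?orbT.
have xa3 : xa = U a \/ xa = D - \sum_(e <- es) L e.
  by rewrite /xa; case: leP => _; [left|right].
(* The remainder [D - xa] is at most the upper sum of the tail: by [DU] if [xa = U a], and otherwise
   because it equals the lower sum. *)
have [||x [xLU xU xD xS]] := IHes (D - xa) ues; [lra | by case: xa3; lra |].
pose y e := if e == a then xa else x e.
have ya : y a = xa by rewrite /y eqxx.
have yx (Q : pred E) : \sum_(e <- es | Q e) y e = \sum_(e <- es | Q e) x e.
  rewrite big_seq_cond [RHS]big_seq_cond; apply: eq_bigr => e /andP[ees _].
  by rewrite /y; case: eqP ees aes => // -> ->.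
exists y; split.
- move=> e; rewrite /y; case: eqP => [->|_]; last exact: xLU.
  by apply/andP; split; case: xa3; lra.
- move=> e; rewrite in_cons => /norP[/negPf nea nes].
  by rewrite /y nea xU.
- by rewrite big_cons ya yx xD; lra.
move=> S m /andP[aS pS]; rewrite !big_cons ya yx.
have [Sa|Sa] /= := boolP (S a).
  move=> m1 m2.
  have LUS : \sum_(e <- es | S e) L e <= \sum_(e <- es | S e) U e.
    by apply: ler_sum => e _.
  have EL : \sum_(e <- es) L e =
      \sum_(e <- es | S e) L e + \sum_(e <- es | ~~ S e) L e.
    by rewrite (bigID S).
  (* If [xa] is not [U a], the second bound on [m] puts [m - xa] below the lower sum over [S], hence
     below the upper one. *)
  suff: m - xa <= \sum_(e <- es | S e) x e by lra.
  by apply: xS => //; case: xa3; lra.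
(* An initial segment that misses the first edge is empty. *)
have S0 (f : E -> R) : \sum_(e <- es | S e) f e = 0.
  rewrite big_seq_cond big1 // => e /andP[ees Se].
  by move/allP/(_ e ees): aS; rewrite Se (negPf Sa).
by rewrite !S0.
Qed.

(** A changed edge contributes its full cost and an unchanged one 0. The hypothesis [0 <= C]
    accounts for the neutral element 0 of the maximum. *)
Lemma objective_le (R : realType) (E : finType) (c w wt : E -> R) (C : R) :
  0 <= C ->
  objective c w wt <= C <-> (forall e, C < c e -> wt e = w e).
Proof.
move=> C0; rewrite /objective; split => [objC e Ce|wtw].
  apply/eqP/negPn/negP => ne.
  have := le_trans (le_bigmax 0 (fun e => c e * hamming (wt e) (w e)) e) objC.
  by rewrite /hamming ne mulr1 leNgt Ce.
apply: bigmax_le => // e _; have [|/wtw->] := leP (c e) C.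
  by rewrite /hamming; case: (_ != _); rewrite ?mulr1 ?mulr0.
by rewrite /hamming eqxx mulr0.
Qed.

Definition restricted_bound (R : realType) (E : finType) (A : {set E})
    (f w : E -> R) (e : E) : R := if e \in A then f e else w e.

Lemma fsum_restricted_bound (R : realType) (E : finType) (A S : {set E})
    (f w : E -> R) :
  fsum (restricted_bound A f w) S = fsum f (S :&: A) + fsum w (S :\: A).
Proof.
rewrite /fsum (big_setID A) /=; congr (_ + _); apply: eq_bigr => e.
  by rewrite /restricted_bound inE => /andP[_ ->].
by rewrite /restricted_bound inE => /andP[/negPf ->].
Qed.

Lemma fsumID (R : realType) (E : finType) (A S : {set E}) (f : E -> R) :
  fsum f S = fsum f (S :&: A) + fsum f (S :\: A).
Proof. by rewrite /fsum (big_setID A). Qed.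

Lemma fsum_le (R : realType) (E : finType) (S : {set E}) (f g : E -> R) :
  (forall e, f e <= g e) -> fsum f S <= fsum g S.
Proof. by move=> fg; apply: ler_sum => e _. Qed.

Lemma sum_seq_fsum (R : realType) (E : finType) (P : {set E}) (es : seq E)
    (S : pred E) (f : E -> R) :
  uniq es -> P =i es ->
  \sum_(e <- es | S e) f e = fsum f (P :&: [set e | S e]).
Proof.
move=> ues Pes; rewrite -big_filter big_uniq ?filter_uniq //.
by apply: eq_bigl => e; rewrite mem_filter !inE Pes andbC.
Qed.

(** The range of [k] keeps [nth] away from its default 0, so the value is the cost of some edge. *)
Lemma cost_value_gt0 (R : realType) (E : finType) (c : E -> R) k :
  (forall e, 0 < c e) -> (1 <= k <= size (cost_values c))%N ->
  0 < cost_value c k.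
Proof.
move=> c0 /andP[k1 ks]; have : cost_value c k \in cost_values c.
  by apply: mem_nth; rewrite prednK.
by rewrite mem_sort mem_undup => /mapP[e _ ->].
Qed.

Theorem theorem1 (R : realType) (V : finType) (adj : rel V) (v1 t0 : V)
    (P : V -> {set edge adj}) (l w u c : edge adj -> R) (D : R) (k : nat)
    (treeT : is_tree adj)
    (t0Y : t0 \in leaves adj v1)
    (pathP : forall t, t \in leaves adj v1 -> is_path_edge_set v1 t (P t))
    (lwu : forall e, l e <= w e <= u e)
    (c_gt0 : forall e, 0 < c e)
    (k_range : (1 <= k <= size (cost_values c))%N) :
  let Y := leaves adj v1 in
  let P0 := P t0 in
  let Ek := cheap_edges c k in
  (exists wt : edge adj -> R,
      feasible Y P t0 l u D wt /\ objective c w wt <= cost_value c k)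
  <->
  (forall t, t \in Y ->
     fsum l (P0 :&: Ek) + fsum w (P0 :\: Ek) <= D /\
     D <= fsum u (P t :&: Ek) + fsum w (P t :\: Ek)) /\
  (forall t, t \in Y ->
     fsum l (P0 :&: Ek) + fsum w (P0 :\: Ek)
     <= fsum l (P t :&: P0 :&: Ek) + fsum u ((P t :\: P0) :&: Ek)
        + fsum w (P t :\: Ek)).
Proof.
move=> Y P0 Ek; case: treeT => symA _ _ acyA.
have Ck0 := ltW (cost_value_gt0 c_gt0 k_range).
pose L := restricted_bound Ek l w; pose U := restricted_bound Ek u w.
have LU e : L e <= U e.
  rewrite /L /U /restricted_bound; case: ifP => // _.
  by case/andP: (lwu e); apply: le_trans.
have cond2E t : fsum l (P t :&: P0 :&: Ek) + fsum u ((P t :\: P0) :&: Ek)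
    + fsum w (P t :\: Ek) = fsum L (P t :&: P0) + fsum U (P t :\: P0).
  rewrite !fsum_restricted_bound (fsumID P0 (P t :\: Ek)).
  rewrite (setIDAC (P t) Ek P0) [P t :\: Ek :\: P0]setDDl setUC -setDDl; lra.
rewrite -fsum_restricted_bound -/L.
have P0L t : fsum L P0 = fsum L (P t :&: P0) + fsum L (P0 :\: P t).
  by rewrite [P t :&: P0]setIC -fsumID.
split=> [[wt [[wtY wtP0 wtlu] /(objective_le _ _ _ Ck0) wtw]]|[cond1 cond2]].
  have Lwt e : L e <= wt e.
    rewrite /L /restricted_bound inE; case: (leP (c e)) => [_|/wtw ->//].
    by case/andP: (wtlu e).
  have wtU e : wt e <= U e.
    rewrite /U /restricted_bound inE; case: (leP (c e)) => [_|/wtw ->//].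
    by case/andP: (wtlu e).
  split=> t tY; rewrite -?fsum_restricted_bound -/U ?cond2E.
    by rewrite -{1}wtP0; split; [|apply: le_trans (wtY t tY) _]; apply: fsum_le.
  (* Removing the common part from [wt(P0) = D <= wt(P t)] leaves
     [wt(P0 :\: P t) <= wt(P t :\: P0)]; bound the left side below by [L] and the right side above
     by [U]. *)
  have := fsum_le (P0 :\: P t) Lwt; have := fsum_le (P t :\: P0) wtU.
  have := wtY t tY; rewrite (fsumID P0 (P t)) (P0L t).
  have := wtP0; rewrite -/P0 (fsumID (P t) P0) [P0 :&: P t]setIC; lra.
have {}cond1 t : t \in Y -> fsum L P0 <= D /\ D <= fsum U (P t).
  by move=> tY; rewrite [fsum U _]fsum_restricted_bound; exact: cond1.
have {}cond2 t : t \in Y -> fsum L P0 <= fsum L (P t :&: P0) + fsum U (P t :\: P0).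
  by move=> tY; rewrite -cond2E; exact: cond2.
have [p /and3P[pp up _] eP0] := pathP t0 t0Y.
have [es ees] := path_edge_seq pp.
have ues : uniq es.
  by rewrite -(map_inj_uniq val_inj) ees consecutive_pairs_uniq.
have P0es : P0 =i es.
  by move=> e; rewrite /P0 eP0 inE -[RHS](mem_map val_inj) ees.
have sumE f : \sum_(e <- es) f e = fsum f P0.
  by rewrite big_uniq //; apply: eq_bigl => e; rewrite P0es.
(* Condition 1 at [t0] itself makes the total [D] attainable on [P0]. *)
have [LD DU] := cond1 t0 t0Y.
have [||wt [wtLU wtU wtD wtS]] := greedy_weights (D := D) ues LU; rewrite ?sumE //.
exists wt; split; last first.
  (* Outside [Ek] both bounds equal [w e], which pins [wt e]. *)
  apply/(objective_le _ _ _ Ck0) => e Ce; apply/eqP.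
  have := wtLU e; rewrite /L /U /restricted_bound inE [c e <= _]leNgt Ce /=.
  by rewrite -eq_le eq_sym.
split=> [t tY||e]; last 2 first.
- by rewrite -sumE.
- have := wtLU e; rewrite /L /U /restricted_bound; case: ifP => // _.
  by case/andP: (lwu e); lra.
have [q /and3P[pq uq _] eP] := pathP t tY.
have prefP : pairwise (fun a b => (b \in P t) ==> (a \in P t)) es.
  have := tree_paths_share_prefix symA acyA pp up pq uq.
  rewrite -ees pairwise_map; apply: sub_pairwise => a b.
  by rewrite eP !inE.
have offP0 : fsum wt (P t :\: P0) = fsum U (P t :\: P0).
  apply: eq_bigr => e; rewrite !inE => /andP[eP0' _].
  by apply: wtU; rewrite -P0es.
(* This [m] is what the shared segment must carry once the edges off [P0] have weight [U]. Its two
   required bounds are conditions 1 and 2 at [t]. *)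
have := wtS _ (D - fsum U (P t :\: P0)) prefP.
have setE (Q : {set edge adj}) : [set e | e \in Q] = Q.
  by apply/setP => e; rewrite inE.
have setCE : P0 :&: [set e | e \notin P t] = P0 :\: P t.
  by apply/setP => e; rewrite !inE andbC.
rewrite !(sum_seq_fsum _ _ ues P0es) setE setCE ![P0 :&: P t]setIC.
have := cond2 t tY; have [_] := cond1 t tY; rewrite (P0L t).
rewrite (fsumID P0 (P t)) [fsum wt (P t)](fsumID P0) offP0 => c1 c2 wtP.
suff: D - fsum U (P t :\: P0) <= fsum wt (P t :&: P0) by lra.
by apply: wtP; lra.
Qed.
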